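(* Let $\alpha_0,\alpha_1,\alpha_2$ be complex parameters with $\alpha_0+\alpha_1+\alpha_2=\frac12$, and consider the Hamiltonian system $$\begin{aligned} \frac{dq_1}{dt}&=2q_1^2+4p_1+2t+4p_2,\\ \frac{dp_1}{dt}&=-4q_1p_1+2q_2p_2-2\alpha_0,\\ \frac{dq_2}{dt}&=q_2^2-4p_2+4p_1-2q_1q_2,\\ \frac{dp_2}{dt}&=-2q_2p_2+2q_1p_2-\alpha_1, \end{aligned}$$ with Hamiltonian $H=2(q_1^2p_1+p_1^2+tp_1+\alpha_0q_1)+q_2^2p_2-2p_2^2+\alpha_1q_2+4p_1p_2-2q_1q_2p_2$. This system admits the affine Weyl group symmetry of type $D_3^{(2)}$ as the group of its Bäcklund transformations, whose generators $s_0,s_1,s_2$ are given, with $( * ):=(q_1,p_1,q_2,p_2,t;\alpha_0,\alpha_1,\alpha_2)$ and $D:=4p_1+8p_2+4q_1q_2-q_2^2+4t$, by $$s_0:( * )\mapsto\left(q_1+\frac{4\alpha_0}{4p_1+q_2^2},\;p_1,\;q_2,\;p_2-\frac{2\alpha_0q_2}{4p_1+q_2^2},\;t;\;-\alpha_0,\;\alpha_1+2\alpha_0,\;\alpha_2\right),$$ $$s_1:( * )\mapsto\left(q_1,\;p_1,\;q_2+\frac{\alpha_1}{p_2},\;p_2,\;t;\;\alpha_0+\alpha_1,\;-\alpha_1,\;\alpha_2+\alpha_1\right),$$ $$s_2:( * )\mapsto\left(q_1+\frac{4\alpha_2}{D},\;p_1-\frac{4\alpha_2q_2}{D}-\fr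ac{16\alpha_2^2}{D^2},\;q_2+\frac{8\alpha_2}{D},\;p_2-\frac{2\alpha_2(2q_1-q_2)}{D},\;t;\;\alpha_0,\;\alpha_1+2\alpha_2,\;-\alpha_2\right).$$
   Context: The $q_i,p_i$ are unknown complex functions of $t$; the system is $dq_i/dt=\partial H/\partial p_i$, $dp_i/dt=-\partial H/\partial q_i$ ($i=1,2$). A Bäcklund transformation here is a birational transformation of the variables and parameters that leaves the form of the system invariant: it sends solutions of the system with parameters $(\alpha_0,\alpha_1,\alpha_2)$ to solutions of the same system with the transformed parameters. The notation $s:( * )\mapsto(\ldots)$ lists the images of $q_1,p_1,q_2,p_2,t,\alpha_0,\alpha_1,\alpha_2$, so each $s_i$ is regarded as acting as an automorphism (by substitution) on rational functions of these variables. The affine Weyl group of type $D_3^{(2)}$ is the Coxeter group with generators $s_0,s_1,s_2$ and defining relations $s_i^2=1$, $(s_0s_1)^4=(s_1s_2)^4=1$, $(s_0s_2)^2=1$. ''Admits the affine Weyl group symmetry of type $D_3^{(2)}$ as the group of its Bäcklund transformations, with generators $s_i$'' means that each $s_i$ is a Bäcklund transformation of the system and that the $s_i$ realize the canonical generators of this Coxeter group. *)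

(* Defs.v *)
From HB Require Import structures.
From mathcomp Require Import all_boot all_order all_algebra.
From mathcomp Require Import fraction.
From mathcomp Require Import complex.
From mathcomp Require Import boolp classical_sets reals topology normedtype derive.
(* The notations of [mpoly] clash with those of the analysis library. *)
From mathcomp Require mpoly.
Import -(notations) mpoly.

Set Implicit Arguments.
Unset Strict Implicit.
Unset Printing Implicit Defensive.

Import GRing.Theory Num.Theory.
Import numFieldNormedType.Exports.

Local Open Scope classical_set_scope.
Local Open Scope ring_scope.

(* [complex R] carries no topology in the libraries; as a [numClosedFieldType]
   it inherits the one induced by the modulus. *)
Definition cplx (R : realType) : numClosedFieldType := complex R.

Record params (F : Type) := Params { al0 : F; al1 : F; al2 : F }.

Record vars (F : Type) :=
  Vars { q1 : F; p1 : F; q2 : F; p2 : F; tm : F; par : params F }.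

Definition map_params (F G : Type) (f : F -> G) (a : params F) : params G :=
  Params (f (al0 a)) (f (al1 a)) (f (al2 a)).

Definition map_vars (F G : Type) (f : F -> G) (x : vars F) : vars G :=
  Vars (f (q1 x)) (f (p1 x)) (f (q2 x)) (f (p2 x)) (f (tm x))
       (map_params f (par x)).

Definition normalized (F : fieldType) (a : params F) : Prop :=
  al0 a + al1 a + al2 a = 1 / 2.

Section System.
Variable F : fieldType.
Implicit Types x : vars F.

Definition hamiltonian x : F :=
  let: Vars q1 p1 q2 p2 t (Params a0 a1 a2) := x in
  2 * (q1 ^+ 2 * p1 + p1 ^+ 2 + t * p1 + a0 * q1)
  + q2 ^+ 2 * p2 - 2 * p2 ^+ 2 + a1 * q2 + 4 * p1 * p2 - 2 * q1 * q2 * p2.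

Definition rhs_q1 x : F :=
  let: Vars q1 p1 q2 p2 t (Params a0 a1 a2) := x in
  2 * q1 ^+ 2 + 4 * p1 + 2 * t + 4 * p2.

Definition rhs_p1 x : F :=
  let: Vars q1 p1 q2 p2 t (Params a0 a1 a2) := x in
  - 4 * q1 * p1 + 2 * q2 * p2 - 2 * a0.

Definition rhs_q2 x : F :=
  let: Vars q1 p1 q2 p2 t (Params a0 a1 a2) := x in
  q2 ^+ 2 - 4 * p2 + 4 * p1 - 2 * q1 * q2.

Definition rhs_p2 x : F :=
  let: Vars q1 p1 q2 p2 t (Params a0 a1 a2) := x in
  - 2 * q2 * p2 + 2 * q1 * p2 - a1.

End System.

Definition is_hamiltonian_system (R : realType) : Prop :=
  forall (q1 p1 q2 p2 t : cplx R) (a : params (cplx R)),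
  let x := Vars q1 p1 q2 p2 t a in
  [/\ is_derive p1 1 (fun z => hamiltonian (Vars q1 z q2 p2 t a)) (rhs_q1 x),
      is_derive q1 1 (fun z => hamiltonian (Vars z p1 q2 p2 t a)) (- rhs_p1 x),
      is_derive p2 1 (fun z => hamiltonian (Vars q1 p1 q2 z t a)) (rhs_q2 x) &
      is_derive q2 1 (fun z => hamiltonian (Vars q1 p1 z p2 t a)) (- rhs_p2 x)].

(* A solution is a curve defined (at least) on [U], on which the last entries
   of [vars] are the independent variable and the constant parameters; the
   derivatives are complex derivatives. *)
Definition solution (R : realType) (a : params (cplx R)) (U : set (cplx R))
    (Y : cplx R -> vars (cplx R)) : Prop :=
  forall t, U t ->
  [/\ tm (Y t) = t, par (Y t) = a &
   [/\ is_derive t 1 (fun u => q1 (Y u)) (rhs_q1 (Y t)),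
       is_derive t 1 (fun u => p1 (Y u)) (rhs_p1 (Y t)),
       is_derive t 1 (fun u => q2 (Y u)) (rhs_q2 (Y t)) &
       is_derive t 1 (fun u => p2 (Y u)) (rhs_p2 (Y t))]].

Section Transformations.
Variable F : fieldType.

Definition s_params (i : 'I_3) (a : params F) : params F :=
  let: Params a0 a1 a2 := a in
  match val i with
  | 0 => Params (- a0) (a1 + 2 * a0) a2
  | 1 => Params (a0 + a1) (- a1) (a2 + a1)
  | _ => Params a0 (a1 + 2 * a2) (- a2)
  end.

Definition s_denom (i : 'I_3) (x : vars F) : F :=
  let: Vars q1 p1 q2 p2 t _ := x in
  match val i with
  | 0 => 4 * p1 + q2 ^+ 2
  | 1 => p2
  | _ => 4 * p1 + 8 * p2 + 4 * q1 * q2 - q2 ^+ 2 + 4 * t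
  end.

Definition s_vars (i : 'I_3) (x : vars F) : vars F :=
  let: Vars q1 p1 q2 p2 t (Params a0 a1 a2 as a) := x in
  let d := s_denom i x in
  match val i with
  | 0 => Vars (q1 + 4 * a0 / d) p1 q2 (p2 - 2 * a0 * q2 / d) t (s_params i a)
  | 1 => Vars q1 p1 (q2 + a1 / d) p2 t (s_params i a)
  | _ => Vars (q1 + 4 * a2 / d)
              (p1 - 4 * a2 * q2 / d - 16 * a2 ^+ 2 / d ^+ 2)
              (q2 + 8 * a2 / d)
              (p2 - 2 * a2 * (2 * q1 - q2) / d) t (s_params i a)
  end.

End Transformations.

(* Where a denominator vanishes the formulas have no meaning (division is total
   in the library), hence the removal of its zeros from [U]. *)
Definition preserves_solutions (R : realType) (i : 'I_3) : Prop :=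
  forall a : params (cplx R), normalized a ->
  normalized (s_params i a) /\
  forall (U : set (cplx R)) (Y : cplx R -> vars (cplx R)),
    open U -> solution a U Y ->
    solution (s_params i a) (U `&` [set t | s_denom i (Y t) != 0])
      (fun t => s_vars i (Y t)).

(* Because of the normalization of the parameters, the field of rational
   functions is purely transcendental over the constants in the seven variables
   q1, p1, q2, p2, t, al0, al1. *)
Definition ratfun (R : realType) : fieldType :=
  {fraction (mpoly 7 (cplx R))}.

Definition rconst (R : realType) (c : cplx R) : ratfun R :=
  FracField.tofrac (mpolyC 7 c).

Definition rvar (R : realType) (k : 'I_7) : ratfun R :=
  FracField.tofrac (mpolyX (cplx R) (mnm1 k)).

Definition generic_vars (R : realType) : vars (ratfun R) :=
  let X k := rvar R (inord k) in
  Vars (X 0) (X 1) (X 2) (X 3) (X 4)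
       (Params (X 5) (X 6) (1 / 2 - X 5 - X 6)).

Definition is_substitution (R : realType) (sigma : ratfun R -> ratfun R)
    (x : vars (ratfun R)) : Prop :=
  (forall c, sigma (rconst c) = rconst c) /\
  map_vars sigma (generic_vars R) = x.

Definition cox_m (i j : 'I_3) : nat :=
  if i == j then 1 else if (i.+1 == j) || (j.+1 == i) then 4 else 2.

(* Words in the generators modulo the defining relations; since the generators
   are involutions, formal inverses are not needed. *)
Inductive cox_eq : seq 'I_3 -> seq 'I_3 -> Prop :=
| cox_rel u v i j :
    cox_eq (u ++ flatten (nseq (cox_m i j) [:: i; j]) ++ v) (u ++ v)
| cox_refl w : cox_eq w w
| cox_sym w w' : cox_eq w w' -> cox_eq w' w
| cox_trans w1 w2 w3 : cox_eq w1 w2 -> cox_eq w2 w3 -> cox_eq w1 w3.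

Definition word_action (T : Type) (f : 'I_3 -> T -> T) (w : seq 'I_3) : T -> T :=
  foldr (fun i g => f i \o g) id w.

(* Main.v *)
From HB Require Import structures.
From Stdlib Require Setoid Morphisms.
Import -(notations) Setoid Morphisms.
Require Import Defs.
From mathcomp Require Import all_boot all_algebra reals.
From mathcomp Require Import fraction generic_quotient ring zify.
From mathcomp Require Import boolp functions classical_sets topology.
From mathcomp Require Import normedtype derive.
From mathcomp Require mpoly.
Import -(notations) mpoly.

(** The theorem has three parts: each s_i is a Baecklund transformation, the
    substitutions s_i are automorphisms of the field of rational functions, and
    the relations between these automorphisms are exactly the Coxeter relations.

    The symmetry of the diagram 0 - 1 - 2 halves the work. The polynomial map
      (q1, p1, q2, p2, t) |-> (- q1, - (p1 + 2 p2 + t + q1^2), q2 - 2 q1, p2, t)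
    with alpha_0 and alpha_2 exchanged is an involution which preserves the
    system, commutes with s_1 and conjugates s_0 to s_2 ([s_vars2_rev]).
    Whatever holds for s_0, or for s_0 and s_1, is thereby transported to s_2,
    or to s_2 and s_1.

    A substitution is studied through the point map [s_vars i] on seven-tuples
    over an arbitrary field. A field morphism commutes with the rational
    operations, so the automorphism attached to a word i_1 .. i_n sends the
    generic point to the image of that point under the point maps of
    i_1, .., i_n, applied in this order ([word_vars_cat]). Hence an identity
    between words of automorphisms is an identity between rational maps. The
    denominator d of s_i is invariant under s_i and s_i is an involution; this
    gives the injectivity of the substitution on polynomials, which is needed to
    extend it to fractions: if a polynomial f is mapped to g / d^n, then g is
    mapped to f d^n, so g cannot vanish unless f does ([lifts_inj]).

    For the faithfulness of the action, let y1 = 1/2 - alpha_0 and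
    y2 = alpha_2. Then s_0 is y1 |-> 1 - y1, s_1 exchanges y1 and y2, and s_2 is
    y2 |-> - y2: the group acts on the plane as the wreath product of the
    infinite dihedral group of the line with Z/2. In the Coxeter group, the
    Coxeter relations suffice to bring a word to the form u (s_1 v s_1) s_1^e,
    with u and v in the dihedral group generated by s_0 and s_1 s_2 s_1, and u
    and v to the form (reflection)(translation) ([normal_formP]). The normal
    form is determined by the affine map induced on the plane, and this map can
    be read off from the images of y1 and y2 ([word_action_wreath]). *)

Set Implicit Arguments.
Unset Strict Implicit.
Unset Printing Implicit Defensive.

Import GRing.Theory Num.Theory numFieldNormedType.Exports.
Local Open Scope ring_scope.

Local Notation tofrac := (@FracField.tofrac _).

(** * The point maps and the reversal of the diagram *)

Definition r0 : 'I_3 := @Ordinal 3 0 isT.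
Definition r1 : 'I_3 := @Ordinal 3 1 isT.
Definition r2 : 'I_3 := @Ordinal 3 2 isT.

Lemma ord3_ind (P : 'I_3 -> Prop) : P r0 -> P r1 -> P r2 -> forall i, P i.
Proof.
by move=> P0 P1 P2 [[|[|[|//]]] lti];
   [move: P0 | move: P1 | move: P2]; congr P; exact: val_inj.
Qed.

(** The expanded forms below keep the denominator folded, so that what is known
    about it can be used instead of its expression. *)
Lemma s_vars0E (F : fieldType) (x : vars F) (d := s_denom r0 x) :
  s_vars r0 x =
  Vars (q1 x + 4 * al0 (par x) / d) (p1 x) (q2 x)
       (p2 x - 2 * al0 (par x) * q2 x / d) (tm x) (s_params r0 (par x)).
Proof. by rewrite /d {d}; case: x => ? ? ? ? ? []. Qed.

Lemma s_vars1E (F : fieldType) (x : vars F) :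
  s_vars r1 x =
  Vars (q1 x) (p1 x) (q2 x + al1 (par x) / p2 x) (p2 x) (tm x)
       (s_params r1 (par x)).
Proof. by case: x => ? ? ? ? ? []. Qed.

Lemma s_vars2E (F : fieldType) (x : vars F) (d := s_denom r2 x) :
  s_vars r2 x =
  Vars (q1 x + 4 * al2 (par x) / d)
       (p1 x - 4 * al2 (par x) * q2 x / d - 16 * al2 (par x) ^+ 2 / d ^+ 2)
       (q2 x + 8 * al2 (par x) / d)
       (p2 x - 2 * al2 (par x) * (2 * q1 x - q2 x) / d)
       (tm x) (s_params r2 (par x)).
Proof. by rewrite /d {d}; case: x => ? ? ? ? ? []. Qed.

Lemma par_s_vars (F : fieldType) i (x : vars F) :
  par (s_vars i x) = s_params i (par x).
Proof. by elim/ord3_ind: i; case: x => ? ? ? ? ? []. Qed.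

Definition rev_params (F : fieldType) (a : params F) : params F :=
  Params (al2 a) (al1 a) (al0 a).

(** The involution which exchanges s_0 and s_2. Its coordinate
    p1 + 2 p2 + t + q1^2 is the analogue for s_2 of the coordinate p1, which s_0
    fixes, and 2 q1 - q2 is the analogue of q2. *)
Definition rev_diagram (F : fieldType) (x : vars F) : vars F :=
  let: Vars q1 p1 q2 p2 t a := x in
  Vars (- q1) (- (p1 + 2 * p2 + t + q1 ^+ 2)) (q2 - 2 * q1) p2 t
    (rev_params a).

Lemma rev_diagramK (F : fieldType) : involutive (@rev_diagram F).
Proof. case=> q1 p1 q2 p2 t [a0 a1 a2] /=; congr Vars; ring. Qed.

Lemma s_denom1_rev (F : fieldType) (x : vars F) :
  s_denom r1 (rev_diagram x) = s_denom r1 x.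
Proof. by case: x => ? ? ? ? ? []. Qed.

Lemma s_denom2_rev (F : fieldType) (x : vars F) :
  s_denom r2 x = - s_denom r0 (rev_diagram x).
Proof. case: x => q1 p1 q2 p2 t [a0 a1 a2] /=; ring. Qed.

Lemma s_vars1_rev (F : fieldType) (x : vars F) :
  s_vars r1 (rev_diagram x) = rev_diagram (s_vars r1 x).
Proof.
case: x => q1 p1 q2 p2 t [a0 a1 a2] /=.
by congr Vars; try ring; congr Params; ring.
Qed.

Lemma s_vars2_rev (F : fieldType) (x : vars F) :
  s_vars r2 x = rev_diagram (s_vars r0 (rev_diagram x)).
Proof.
rewrite s_vars0E s_vars2E s_denom2_rev; move: (s_denom r0 _) => d.
case: x => q1 p1 q2 p2 t [a0 a1 a2] /=.
by rewrite sqrrN invrN -exprVn; congr Vars; ring.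
Qed.

Lemma s_denomK (F : fieldType) i (x : vars F) :
  s_denom i (s_vars i x) = s_denom i x.
Proof.
have denom0K y : s_denom r0 (s_vars r0 y) = s_denom r0 y :> F.
  by case: y => ? ? ? ? ? [].
elim/ord3_ind: i => //; first by case: x => ? ? ? ? ? [].
by rewrite s_vars2_rev s_denom2_rev rev_diagramK denom0K -s_denom2_rev.
Qed.

Lemma s_varsK (F : fieldType) i (x : vars F) :
  s_denom i x != 0 -> s_vars i (s_vars i x) = x.
Proof.
have vars0K y : s_denom r0 y != 0 -> s_vars r0 (s_vars r0 y) = y :> vars F.
  case: y => q1 p1 q2 p2 t [a0 a1 a2] /= d0.
  by congr Vars; try (field => //); congr Params; ring.
elim/ord3_ind: i; first exact: vars0K.
  case: x => q1 p1 q2 p2 t [a0 a1 a2] /= d0.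
  by congr Vars; try (field => //); congr Params; ring.
rewrite s_denom2_rev oppr_eq0 => d0.
by rewrite !s_vars2_rev !rev_diagramK vars0K // rev_diagramK.
Qed.

(** * The Coxeter relations between the point maps *)

(** The denominators of s_0 and s_2 Poisson commute, so that each of the two
    maps fixes the denominator of the other. *)
Lemma s_denom02 (F : fieldType) (x : vars F) :
  s_denom r0 (s_vars r2 x) = s_denom r0 x.
Proof.
rewrite s_vars2E; move: (s_denom r2 x) => d.
by case: x => q1 p1 q2 p2 t [a0 a1 a2] /=; rewrite -exprVn; ring.
Qed.

Lemma s_denom20 (F : fieldType) (x : vars F) :
  s_denom r2 (s_vars r0 x) = s_denom r2 x.
Proof.
rewrite -{2}[x]rev_diagramK !s_denom2_rev -[in RHS]s_denom02 s_vars2_rev.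
by rewrite !rev_diagramK.
Qed.

Lemma s_vars_comm02 (F : fieldType) (x : vars F) :
  s_vars r0 (s_vars r2 x) = s_vars r2 (s_vars r0 x).
Proof.
rewrite [LHS]s_vars0E s_denom02 [RHS]s_vars2E s_denom20 s_vars0E s_vars2E.
move: (s_denom r0 x) (s_denom r2 x) => d0 d2.
case: x => q1 p1 q2 p2 t [a0 a1 a2] /=.
by congr Vars; try ring; congr Params; ring.
Qed.

Lemma s_vars_braid01 (F : fieldType) (x : vars F) :
  s_denom r0 x != 0 -> s_denom r1 x != 0 ->
  s_denom r0 (s_vars r1 x) != 0 -> s_denom r1 (s_vars r0 x) != 0 ->
  s_denom r1 (s_vars r0 (s_vars r1 x)) != 0 ->
  s_denom r0 (s_vars r1 (s_vars r0 x)) != 0 ->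
  s_denom r0 (s_vars r1 (s_vars r0 (s_vars r1 x))) != 0 ->
  s_denom r1 (s_vars r0 (s_vars r1 (s_vars r0 x))) != 0 ->
  s_vars r0 (s_vars r1 (s_vars r0 (s_vars r1 x))) =
  s_vars r1 (s_vars r0 (s_vars r1 (s_vars r0 x))).
Proof.
case: x => q1 p1 q2 p2 t [a b a2] /=.
set d := 4 * p1 + q2 ^+ 2; set q' := q2 + b / p2; set d' := 4 * p1 + q' ^+ 2.
set p' := p2 - 2 * a * q2 / d; set p'' := p2 - 2 * (a + b) * q' / d'.
set q'' := q2 + (b + 2 * a) / p'; set e := 4 * p1 + q'' ^+ 2.
set e' := 4 * p1 + (q' + _) ^+ 2; set r := p' - _ / e.
move=> d0 p0 d'0 p'0 p''0 e0 e'0 r0.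
(* The numerators of p', e, d', p'', e' and r, up to nonzero factors: these are
   the polynomials left when all fractions are cleared. *)
pose nF := p2 * d - 2 * a * q2.
pose nG := 4 * p1 * nF ^+ 2 + (q2 * nF + (b + 2 * a) * d) ^+ 2.
pose nE := 4 * p1 * p2 ^+ 2 + (q2 * p2 + b) ^+ 2.
pose nH := p2 * nE - 2 * (a + b) * (q2 * p2 + b) * p2.
pose nK := 4 * p1 * (p2 * nH) ^+ 2 +
           ((q2 * p2 + b) * nH + (- b + 2 * (a + b)) * nE * p2) ^+ 2.
pose nL := nF * nG +
   - (2 * (- a + (b + 2 * a)) * (q2 * nF + (b + 2 * a) * d) * nF) * d.
have F0 : nF != 0.
  by rewrite (_ : nF = p' * d) ?mulf_neq0 // /nF /p'; field.
have G0 : nG != 0.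
  rewrite (_ : nG = e * nF ^+ 2) ?mulf_neq0 ?expf_neq0 //.
  by rewrite /nG /nF /e /q'' /p'; field; apply/andP.
have E0 : nE != 0.
  rewrite (_ : nE = d' * p2 ^+ 2) ?mulf_neq0 ?expf_neq0 //.
  by rewrite /nE /d' /q'; field.
have H0 : nH != 0.
  rewrite (_ : nH = p'' * nE) ?mulf_neq0 ?expf_neq0 //.
  by rewrite /nH /nE /p'' /d' /q'; field; apply/andP.
have K0 : nK != 0.
  rewrite (_ : nK = e' * (p2 * nH) ^+ 2) ?(mulf_neq0, expf_neq0) //.
  by rewrite /nK /nH /nE /e' /p'' /d' /q'; field; apply/and3P.
have L0 : nL != 0.
  rewrite (_ : nL = r * (d * nG)) ?mulf_neq0 //.
  by rewrite /nL /nG /nF /r /e /q'' /p' /d; field; apply/and3P.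
congr Vars; last by congr Params; ring.
- rewrite /e' /p'' /d' /q' /e /q'' /p' /d; field.
  by do ?[apply/andP; split].
- rewrite /r /p'' /d' /q' /e /q'' /p' /d; field.
  by do ?[apply/andP; split].
- rewrite /e' /r /p'' /d' /q' /e /q'' /p' /d; field.
  by do ?[apply/andP; split].
Qed.

(** This is [s_vars_braid01] at the image of x under the diagram reversal. *)
Lemma s_vars_braid12 (F : fieldType) (x : vars F) :
  s_denom r2 x != 0 -> s_denom r1 x != 0 ->
  s_denom r2 (s_vars r1 x) != 0 -> s_denom r1 (s_vars r2 x) != 0 ->
  s_denom r1 (s_vars r2 (s_vars r1 x)) != 0 ->
  s_denom r2 (s_vars r1 (s_vars r2 x)) != 0 ->
  s_denom r2 (s_vars r1 (s_vars r2 (s_vars r1 x))) != 0 ->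
  s_denom r1 (s_vars r2 (s_vars r1 (s_vars r2 x))) != 0 ->
  s_vars r2 (s_vars r1 (s_vars r2 (s_vars r1 x))) =
  s_vars r1 (s_vars r2 (s_vars r1 (s_vars r2 x))).
Proof.
have rev1 y := esym (@s_vars1_rev F y).
rewrite !s_vars2_rev !s_denom2_rev !oppr_eq0 !(rev_diagramK, rev1).
rewrite !s_denom1_rev -(s_denom1_rev x).
by move=> *; rewrite s_vars_braid01.
Qed.

(** * The Hamiltonian form and the transport of solutions *)

Lemma is_derive_add (K : numClosedFieldType) (f g : K -> K) (t a b : K) :
  is_derive t 1 f a -> is_derive t 1 g b ->
  is_derive t 1 (fun u => f u + g u) (a + b).
Proof. exact: is_deriveD. Qed.

Lemma is_derive_opp (K : numClosedFieldType) (f : K -> K) (t a : K) :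
  is_derive t 1 f a -> is_derive t 1 (fun u => - f u) (- a).
Proof. exact: is_deriveN. Qed.

Lemma is_derive_mul (K : numClosedFieldType) (f g : K -> K) (t a b : K) :
  is_derive t 1 f a -> is_derive t 1 g b ->
  is_derive t 1 (fun u => f u * g u) (f t * b + g t * a).
Proof. exact: is_deriveM. Qed.

Lemma is_derive_exp (K : numClosedFieldType) n (f : K -> K) (t a : K) :
  is_derive t 1 f a ->
  is_derive t 1 (fun u => f u ^+ n) (n%:R * f t ^+ n.-1 * a).
Proof. by move=> df; have := is_deriveX n df; rewrite exprfctE. Qed.

Lemma is_derive_inv (K : numClosedFieldType) (f : K -> K) (t a : K) :
  f t != 0 -> is_derive t 1 f a ->
  is_derive t 1 (fun u => (f u)^-1) (- a / f t ^+ 2).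
Proof.
move=> ft0 [df <-]; apply: DeriveDef; first exact: derivableV.
by rewrite deriveV // mulrC mulrN -mulNr.
Qed.

Lemma is_derive_const (K : numClosedFieldType) (c t : K) :
  is_derive t 1 (fun=> c) 0.
Proof. exact: is_derive_cst. Qed.

(* Differentiation directed by the syntax of the function. The rules are applied
   without type class resolution, which would solve the subgoals through sums
   and products in the ring of functions, and leave derivatives that [ring] does
   not read. *)
Ltac derive_rules :=
  lazymatch goal with
  | H : is_derive ?t ?v ?f _ |- is_derive ?t ?v ?f _ =>
      notypeclasses refine H
  | |- is_derive _ _ (fun _ => ?c) _ =>
      notypeclasses refine (is_derive_const _ _)
  | |- is_derive _ _ (fun u => u) _ =>
      notypeclasses refine (is_derive_id _ _)
  | |- is_derive _ _ (fun u => _ + _) _ =>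
      notypeclasses refine (is_derive_add _ _); derive_rules
  | |- is_derive _ _ (fun u => - _) _ =>
      notypeclasses refine (is_derive_opp _); derive_rules
  | |- is_derive _ _ (fun u => _ * _) _ =>
      notypeclasses refine (is_derive_mul _ _); derive_rules
  | |- is_derive _ _ (fun u => _ ^+ _) _ =>
      notypeclasses refine (is_derive_exp _ _); derive_rules
  | |- is_derive _ _ (fun u => _ ^-1) _ =>
      notypeclasses refine (is_derive_inv _ _); [ |derive_rules]
  | |- is_derive ?t ?v (GRing.mul ?c) ?d =>
      change (is_derive t v (fun u => c * u) d); derive_rules
  | |- is_derive ?t ?v (GRing.add ?c) ?d =>
      change (is_derive t v (fun u => c + u) d); derive_rules
  end.

Ltac differentiate :=
  notypeclasses refine (is_derive_eq _ _); [derive_rules |].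

Lemma hamiltonian_systemP (R : realType) : is_hamiltonian_system R.
Proof.
move=> q1 p1 q2 p2 t [a0 a1 a2] x.
by split; rewrite /x /=; differentiate; rewrite ?expr1 ?expr0; ring.
Qed.

Section Solutions.
Local Open Scope classical_set_scope.
Variable R : realType.
Implicit Types (a : params (cplx R)) (Y : cplx R -> vars (cplx R)).
Implicit Types (t : cplx R).

(** The germ at t of a solution. Being a solution on an open set amounts to
    this at each of its points, and the condition that a denominator does not
    vanish then concerns one point at a time. *)
Definition solves_at a Y t : Prop :=
  (\forall u \near t, tm (Y u) = u /\ par (Y u) = a) /\
  [/\ is_derive t 1 (fun u => q1 (Y u)) (rhs_q1 (Y t)),
      is_derive t 1 (fun u => p1 (Y u)) (rhs_p1 (Y t)),
      is_derive t 1 (fun u => q2 (Y u)) (rhs_q2 (Y t)) &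
      is_derive t 1 (fun u => p2 (Y u)) (rhs_p2 (Y t))].

Lemma solution_solves_at a U Y t :
  open U -> U t -> solution a U Y -> solves_at a Y t.
Proof.
move=> Uo Ut sol; split; last by have [] := sol t Ut.
have : nbhs t U by exact: open_nbhs_nbhs.
by apply: filterS => u /sol [].
Qed.

Lemma solves_at_solution a U Y :
  (forall t, U t -> solves_at a Y t) -> solution a U Y.
Proof. by move=> sol t /sol [/nbhs_singleton [tmE parE] d]. Qed.

(** Near t the last entries of Y are the independent variable and constants, so
    that they can be differentiated together with the unknown functions. *)
Lemma solves_at_derive a Y t :
  solves_at a Y t ->
  [/\ is_derive t 1 (fun u => tm (Y u)) 1,
      is_derive t 1 (fun u => al0 (par (Y u))) 0,
      is_derive t 1 (fun u => al1 (par (Y u))) 0 &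
      is_derive t 1 (fun u => al2 (par (Y u))) 0].
Proof.
case=> tpE _; split.
- apply: near_eq_is_derive (is_derive_id t 1).
  by apply: filterS tpE => u [].
- apply: near_eq_is_derive (is_derive_const (al0 a) t).
  by apply: filterS tpE => u [_ ->].
- apply: near_eq_is_derive (is_derive_const (al1 a) t).
  by apply: filterS tpE => u [_ ->].
- apply: near_eq_is_derive (is_derive_const (al2 a) t).
  by apply: filterS tpE => u [_ ->].
Qed.

(** Presenting a solution by its eight component functions lets the formulas
    of the transformations compute. *)
Lemma solves_at_ind a t (P : (cplx R -> vars (cplx R)) -> Prop) :
  (forall f1 f2 f3 f4 s b0 b1 b2 : cplx R -> cplx R,
    let Y u := Vars (f1 u) (f2 u) (f3 u) (f4 u) (s u)
                    (Params (b0 u) (b1 u) (b2 u)) in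
    s t = t -> Params (b0 t) (b1 t) (b2 t) = a ->
    (\forall u \near t, s u = u /\ Params (b0 u) (b1 u) (b2 u) = a) ->
    is_derive t 1 s 1 ->
    is_derive t 1 b0 0 -> is_derive t 1 b1 0 -> is_derive t 1 b2 0 ->
    is_derive t 1 f1 (rhs_q1 (Y t)) ->
    is_derive t 1 f2 (rhs_p1 (Y t)) ->
    is_derive t 1 f3 (rhs_q2 (Y t)) ->
    is_derive t 1 f4 (rhs_p2 (Y t)) -> P Y) ->
  forall Y, solves_at a Y t -> P Y.
Proof.
move=> PP Y sol; have [dt da0 da1 da2] := solves_at_derive sol.
pose b u := Params (al0 (par (Y u))) (al1 (par (Y u))) (al2 (par (Y u))).
have bE u : b u = par (Y u) by rewrite /b; case: (par _).
pose Z u := Vars (q1 (Y u)) (p1 (Y u)) (q2 (Y u)) (p2 (Y u)) (tm (Y u)) (b u).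
have ZE u : Z u = Y u by rewrite /Z bE; case: (Y u).
case: sol => tpE [dq1 dp1 dq2 dp2].
have [tmE parE] := nbhs_singleton tpE.
have -> : Y = Z by apply: funext => u; rewrite ZE.
refine (PP _ _ _ _ _ _ _ _ tmE _ _ dt da0 da1 da2 _ _ _ _);
  rewrite -/(b t) -?/(Z t) ?ZE ?bE.
- exact: parE.
- by apply: filterS tpE => u; rewrite -/(b u) bE.
- exact: dq1.
- exact: dp1.
- exact: dq2.
- exact: dp2.
Qed.

(** The derivative of the explicit t in the second coordinate contributes - 1,
    which is - 2 (alpha_0 + alpha_1 + alpha_2): it is the normalization of the
    parameters that makes the reversal a symmetry of the system. *)
Lemma solves_at_rev a Y t :
  normalized a -> solves_at a Y t ->
  solves_at (rev_params a) (fun u => rev_diagram (Y u)) t.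
Proof.
move=> na; move: Y.
pose P Y := solves_at (rev_params a) (fun u => rev_diagram (Y u)) t.
apply: (@solves_at_ind a t P).
move=> f1 f2 f3 f4 s b0 b1 b2 Y tmE parE tpE; rewrite {}/Y {}/P /=.
move=> ds db0 db1 db2 df1 df2 df3 df4.
split => /=; first by apply: filterS tpE => u [? <-].
move: na; rewrite /normalized -parE /= => na.
have b2E : b2 t = 1 / 2 - b0 t - b1 t by rewrite -na; ring.
by split; differentiate; rewrite ?expr1 ?expr0 ?tmE ?b2E; field.
Qed.

Lemma solves_at_s0 a Y t :
  solves_at a Y t -> s_denom r0 (Y t) != 0 ->
  solves_at (s_params r0 a) (fun u => s_vars r0 (Y u)) t.
Proof.
move: Y; pose P Y := s_denom r0 (Y t) != 0 ->
  solves_at (s_params r0 a) (fun u => s_vars r0 (Y u)) t.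
apply: (@solves_at_ind a t P).
move=> f1 f2 f3 f4 s b0 b1 b2 Y tmE parE tpE; rewrite {}/Y {}/P /=.
move=> ds db0 db1 db2 df1 df2 df3 df4 d0.
split => /=; first by apply: filterS tpE => u [? <-].
by split; differentiate; try exact: d0; rewrite ?expr1 ?expr0 ?tmE; field.
Qed.

Lemma solves_at_s1 a Y t :
  solves_at a Y t -> s_denom r1 (Y t) != 0 ->
  solves_at (s_params r1 a) (fun u => s_vars r1 (Y u)) t.
Proof.
move: Y; pose P Y := s_denom r1 (Y t) != 0 ->
  solves_at (s_params r1 a) (fun u => s_vars r1 (Y u)) t.
apply: (@solves_at_ind a t P).
move=> f1 f2 f3 f4 s b0 b1 b2 Y tmE parE tpE; rewrite {}/Y {}/P /=.
move=> ds db0 db1 db2 df1 df2 df3 df4 d0.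
split => /=; first by apply: filterS tpE => u [? <-].
by split; differentiate; try exact: d0; rewrite ?expr1 ?expr0 ?tmE; field.
Qed.

Lemma normalized_s (F : fieldType) i (a : params F) :
  normalized a -> normalized (s_params i a).
Proof.
rewrite /normalized; case: a => a0 a1 a2 /= <-.
by elim/ord3_ind: i => /=; ring.
Qed.

Lemma normalized_rev (F : fieldType) (a : params F) :
  normalized a -> normalized (rev_params a).
Proof. by rewrite /normalized => <- /=; ring. Qed.

Lemma solves_at_s i a Y t :
  normalized a -> solves_at a Y t -> s_denom i (Y t) != 0 ->
  solves_at (s_params i a) (fun u => s_vars i (Y u)) t.
Proof.
elim/ord3_ind: i => na sol; [exact: solves_at_s0|exact: solves_at_s1|].
rewrite s_denom2_rev oppr_eq0 => d0.
have -> : (fun u => s_vars r2 (Y u)) =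
    fun u => rev_diagram (s_vars r0 (rev_diagram (Y u))).
  by apply: funext => u; rewrite s_vars2_rev.
have -> : s_params r2 a = rev_params (s_params r0 (rev_params a)).
  by case: a {na sol}.
apply: solves_at_rev; first exact/normalized_s/normalized_rev.
by apply: solves_at_s0 d0; exact: solves_at_rev.
Qed.

Lemma preserves_solutionsP i : preserves_solutions R i.
Proof.
move=> a na; split=> [|U Y Uo sol]; first exact: normalized_s.
apply: solves_at_solution => t [Ut dt].
exact/solves_at_s/dt/(solution_solves_at Uo).
Qed.

End Solutions.

(** * Normal forms in the Coxeter group *)

Local Notation "w =c w'" := (cox_eq w w') (at level 70).

#[local] Hint Resolve cox_refl : core.

#[local] Instance cox_eq_equiv : Equivalence cox_eq.
Proof. split; [exact: cox_refl|exact: cox_sym|exact: cox_trans]. Qed.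

Lemma cox_eq_ctx u v w w' : w =c w' -> u ++ w ++ v =c u ++ w' ++ v.
Proof.
elim=> {w w'} [x y i j|w|w w' _|w1 w2 w3 _ e12 _ e23].
- by rewrite -!catA !(catA u); exact: cox_rel.
- exact: cox_refl.
- exact: cox_sym.
- exact: cox_trans e12 e23.
Qed.

#[local] Instance cox_eq_cat :
  Proper (respectful cox_eq (respectful cox_eq cox_eq)) (@cat 'I_3).
Proof.
move=> u u' eu v v' ev; apply: (@cox_trans _ (u' ++ v)).
  exact: (cox_eq_ctx [::] v eu).
by have := cox_eq_ctx u' [::] ev; rewrite !cats0.
Qed.

#[local] Instance cox_eq_cons i : Proper (respectful cox_eq cox_eq) (cons i).
Proof. by move=> w w' e; have := cox_eq_ctx [:: i] [::] e; rewrite !cats0. Qed.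

Lemma cox_rel0 i j : flatten (nseq (cox_m i j) [:: i; j]) =c [::].
Proof. by have := cox_rel [::] [::] i j; rewrite cats0. Qed.

Lemma cox_invol i w : i :: i :: w =c w.
Proof. by have := cox_rel [::] w i i; rewrite /cox_m eqxx. Qed.

Lemma cox_cat_rev w : w ++ rev w =c [::].
Proof.
elim: w => //= i w IHw.
by rewrite rev_cons -cats1 catA IHw /= cox_invol.
Qed.

Lemma cox_swap u w : u ++ u =c [::] -> u ++ w =c rev u ++ w.
Proof.
move=> uu1; have uV : u =c rev u.
  by rewrite -[X in X =c _]cats0 -(cox_cat_rev u) catA uu1.
by rewrite {1}uV.
Qed.

Lemma cox_comm02 w : r0 :: r2 :: w =c r2 :: r0 :: w.
Proof. exact: (@cox_swap [:: r0; r2] w (cox_rel0 r0 r2)). Qed.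

Lemma cox_braid01 w : [:: r0, r1, r0, r1 & w] =c [:: r1, r0, r1, r0 & w].
Proof. exact: (@cox_swap [:: r0; r1; r0; r1] w (cox_rel0 r0 r1)). Qed.

Lemma cox_braid12 w : [:: r1, r2, r1, r2 & w] =c [:: r2, r1, r2, r1 & w].
Proof. exact: (@cox_swap [:: r1; r2; r1; r2] w (cox_rel0 r1 r2)). Qed.

(** The letters s_0 and s_1 s_2 s_1 are the reflections of the y1 line in 1/2
    and in 0; they generate an infinite dihedral group. *)
Definition dword (s : seq bool) : seq 'I_3 :=
  flatten [seq if x then [:: r1; r2; r1] else [:: r0] | x <- s].

(** The conjugates s_1 s_0 s_1 and s_2 of the two letters act on the y2 line.
    They commute with the letters, hence so do the two dihedral groups. *)
Lemma dword_comm2 s w : r2 :: dword s ++ w =c dword s ++ r2 :: w.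
Proof.
elim: s => //= -[] s IHs /=.
  by rewrite -cox_braid12 IHs.
by rewrite -cox_comm02 IHs.
Qed.

Lemma dword_comm101 s w :
  [:: r1, r0, r1 & dword s ++ w] =c dword s ++ [:: r1, r0, r1 & w].
Proof.
elim: s => //= -[] s IHs /=.
  by rewrite cox_invol cox_comm02 -IHs cox_invol.
by rewrite -cox_braid01 IHs.
Qed.

Lemma dword_comm_conj s t w :
  r1 :: dword s ++ r1 :: dword t ++ w =c dword t ++ r1 :: dword s ++ r1 :: w.
Proof.
elim: s => [|[] s IHs] /=.
- by rewrite !cox_invol.
- by rewrite cox_invol IHs dword_comm2 cox_invol.
- by rewrite -(cox_invol r1 (dword s ++ _)) IHs dword_comm101 cox_invol.
Qed.

(** The element y |-> n + (-1)^e y of the dihedral group: the product of the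
    letters true and false is the translation by 1, and true is y |-> - y. *)
Definition dlist (n : int) (e : bool) : seq bool :=
  (if e then [:: true] else [::]) ++
  match n with
  | Posz k => flatten (nseq k [:: true; false])
  | Negz k => flatten (nseq k.+1 [:: false; true])
  end.

Lemma dlist_refl_b n e w :
  [:: r1, r2, r1 & dword (dlist n e) ++ w] =c dword (dlist n (~~ e)) ++ w.
Proof. by case: e; rewrite //= !(cox_invol r1, cox_invol r2). Qed.

(** Substituting 1 - y for y in n + (-1)^e y. *)
Lemma dlist_refl_a n e w :
  r0 :: dword (dlist n e) ++ w =c dword (dlist (n + (-1) ^+ e) (~~ e)) ++ w.
Proof.
case: e; rewrite ?expr0 ?expr1.
  case: n => [[|n]|n].
  - by rewrite (_ : Posz 0 - 1 = Negz 0); last lia.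
  - rewrite (_ : Posz n.+1 - 1 = Posz n); last lia.
    by rewrite /= !(cox_invol r0, cox_invol r1, cox_invol r2).
  - by rewrite (_ : Negz n - 1 = Negz n.+1); last lia.
case: n => [n|[|n]].
- rewrite (_ : Posz n + 1 = Posz n.+1); last lia.
  by rewrite /= !(cox_invol r0, cox_invol r1, cox_invol r2).
- rewrite (_ : Negz 0 + 1 = Posz 0); last lia.
  by rewrite /= !(cox_invol r0).
- rewrite (_ : Negz n.+1 + 1 = Negz n); last lia.
  by rewrite /= !(cox_invol r0).
Qed.

(** [Wreath n1 e1 n2 e2 s] stands for the affine substitution which sends y1 to
    n1 + (-1)^e1 y1 and y2 to n2 + (-1)^e2 y2, the two images being exchanged
    when s holds. *)
Inductive wreath := Wreath of int & bool & int & bool & bool.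

Definition wact (i : 'I_3) (g : wreath) : wreath :=
  let: Wreath n1 e1 n2 e2 s := g in
  match val i with
  | 0 => Wreath (n1 + (-1) ^+ e1) (~~ e1) n2 e2 s
  | 1 => Wreath n2 e2 n1 e1 (~~ s)
  | _ => Wreath n1 e1 n2 (~~ e2) s
  end.

Definition wreath_of_word (w : seq 'I_3) : wreath :=
  foldr wact (Wreath 0 false 0 false false) w.

Definition normal_form (g : wreath) : seq 'I_3 :=
  let: Wreath n1 e1 n2 e2 s := g in
  dword (dlist n1 e1) ++ r1 :: dword (dlist n2 e2) ++
  r1 :: (if s then [:: r1] else [::]).

Lemma normal_form_act i g : i :: normal_form g =c normal_form (wact i g).
Proof.
case: g => n1 e1 n2 e2 s; elim/ord3_ind: i => /=.
- exact: dlist_refl_a.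
- by rewrite dword_comm_conj; case: s; rewrite /= ?cox_invol.
- by rewrite dword_comm2 -(cox_invol r1 (r2 :: _)) dlist_refl_b.
Qed.

Lemma normal_formP w : w =c normal_form (wreath_of_word w).
Proof.
elim: w => [|i w IHw] /=; first by rewrite cox_invol.
by rewrite {1}IHw normal_form_act.
Qed.

Lemma wreath_of_word_inj w w' :
  wreath_of_word w = wreath_of_word w' -> w =c w'.
Proof. by move=> e; rewrite (normal_formP w) (normal_formP w') e. Qed.

(** The relations are assumed on a stable subset only, since the rational maps
    satisfy them only where no denominator vanishes. *)
Lemma cox_action_rel (T : Type) (P : T -> Prop) (st : 'I_3 -> T -> T) i j x :
  (forall k y, P y -> P (st k y)) ->
  (forall k y, P y -> st k (st k y) = y) ->
  (forall y, P y -> st r0 (st r2 y) = st r2 (st r0 y)) ->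
  (forall y, P y -> st r0 (st r1 (st r0 (st r1 y))) =
                    st r1 (st r0 (st r1 (st r0 y)))) ->
  (forall y, P y -> st r2 (st r1 (st r2 (st r1 y))) =
                    st r1 (st r2 (st r1 (st r2 y)))) ->
  P x ->
  foldl (fun y k => st k y) x (flatten (nseq (cox_m i j) [:: i; j])) = x.
Proof.
move=> Pst stK comm02 braid01 braid12 Px.
have stP1 k := Pst k _ Px; have stP2 k k' := Pst k _ (stP1 k').
have stP3 k k' k'' := Pst k _ (stP2 k' k'').
have stP4 k k' k'' k3 := Pst k _ (stP3 k' k'' k3).
elim/ord3_ind: i; elim/ord3_ind: j => /=; rewrite ?stK //.
- by rewrite -[LHS]braid01 // !stK //; do ?apply: Pst.
- by rewrite -[in LHS]comm02 ?stK //; do ?apply: Pst.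
- by rewrite [LHS]braid01 // !stK //; do ?apply: Pst.
- by rewrite [LHS]braid12 // !stK //; do ?apply: Pst.
- by rewrite [in LHS]comm02 ?stK //; do ?apply: Pst.
- by rewrite -[LHS]braid12 // !stK //; do ?apply: Pst.
Qed.

(** * Morphisms from polynomials and from fractions *)

Lemma frac_quotient (A : idomainType) (x : {fraction A}) :
  exists n d, d != 0 /\ x = tofrac n / tofrac d.
Proof.
elim/quotW: x => r; exists (frac r).1, (frac r).2.
have d0 := denom_ratioP r; split=> //.
apply: (@mulIf _ (tofrac (frac r).2)); first by rewrite tofrac_eq0.
rewrite divfK ?tofrac_eq0 //; unlock FracField.tofrac.
rewrite -[LHS]FracField.pi_mul; apply/eqmodP => /=.
rewrite FracField.equivfE /FracField.mulf /=.
by rewrite !numden_Ratio ?oner_neq0 ?mulr1 // mulrC.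
Qed.

Lemma frac_extension (A : idomainType) (L : fieldType)
    (f : {rmorphism A -> L}) :
  (forall a, f a = 0 -> a = 0) ->
  exists g : {rmorphism {fraction A} -> L}, forall a, g (tofrac a) = f a.
Proof.
move=> f_inj.
have f0 a : a != 0 -> f a != 0 by apply: contra_neq => /f_inj.
have /choice [nd ndP] : forall x : {fraction A},
    exists nd : A * A, nd.2 != 0 /\ x = tofrac nd.1 / tofrac nd.2.
  by move=> x; have [n [d nd]] := frac_quotient x; exists (n, d).
pose g x := f (nd x).1 / f (nd x).2.
have gE n d : d != 0 -> g (tofrac n / tofrac d) = f n / f d.
  move=> d0; rewrite /g.
  case: (nd _) (ndP (tofrac n / tofrac d)) => n' d' /= [d'0 /eqP].
  rewrite eqr_div ?tofrac_eq0 // -!rmorphM tofrac_eq => /eqP eqnd.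
  by apply/eqP; rewrite eqr_div ?f0 // -!rmorphM eqnd.
have g_tofrac a : g (tofrac a) = f a.
  by rewrite -[tofrac a]divr1 -(rmorph1 tofrac) gE ?oner_neq0 // rmorph1 divr1.
have gB : zmod_morphism g.
  move=> x y; have [n [d [d0 ->]]] := frac_quotient x.
  have [m [e [e0 ->]]] := frac_quotient y.
  rewrite !gE // -!mulNr -!rmorphN !addf_div ?tofrac_eq0 ?f0 //.
  by rewrite -!rmorphM -!rmorphD gE ?mulf_neq0.
have gM : monoid_morphism g.
  split=> [|x y]; first by rewrite -(rmorph1 tofrac) g_tofrac rmorph1.
  have [n [d [d0 ->]]] := frac_quotient x.
  have [m [e [e0 ->]]] := frac_quotient y.
  by rewrite !gE // !mulf_div -!rmorphM gE ?mulf_neq0.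
pose gB' := GRing.isZmodMorphism.Build _ _ g gB.
pose gM' := GRing.isMonoidMorphism.Build _ _ g gM.
by exists (HB.pack_for {rmorphism {fraction A} -> L} g gB' gM').
Qed.

Lemma frac_rmorph_eq (A : idomainType) (L : fieldType)
    (f g : {rmorphism {fraction A} -> L}) :
  (forall a, f (tofrac a) = g (tofrac a)) -> f =1 g.
Proof.
move=> fg x; have [n [d [_ ->]]] := frac_quotient x.
by rewrite !fmorph_div !fg.
Qed.

Lemma mpoly_alg_ind (C : comNzRingType) n (P : mpoly n C -> Prop) :
  (forall c, P (mpolyC n c)) -> (forall i, P (mpolyX C (mnm1 i))) ->
  (forall p q, P p -> P q -> P (p + q)) ->
  (forall p q, P p -> P q -> P (p * q)) -> forall p, P p.
Proof.
move=> PC PX PD PM; apply: (mpolyind (P := P)) => [|c m p _ _ Pp].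
  by rewrite -(mpolyC0 n C).
apply: PD => //; rewrite -mul_mpolyC; apply: (PM) => //; rewrite mpolyXE_id.
have P1 : P 1 by rewrite -(mpolyC1 n C).
apply: (big_ind P) => [||i _]; [exact: P1|exact: PM|].
by elim: (m i) => [|k IHk]; rewrite ?expr0 // exprS; exact: PM.
Qed.

(** * Parametricity of the point maps *)

Definition vars_rel (F G : Type) (r : F -> G -> Prop)
    (x : vars F) (y : vars G) : Prop :=
  [/\ [/\ r (q1 x) (q1 y), r (p1 x) (p1 y), r (q2 x) (q2 y), r (p2 x) (p2 y) &
          r (tm x) (tm y)],
      r (al0 (par x)) (al0 (par y)), r (al1 (par x)) (al1 (par y)) &
      r (al2 (par x)) (al2 (par y))].

Definition ring_rel (F G : pzRingType) (r : F -> G -> Prop) : Prop :=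
  [/\ forall n, r n%:R n%:R,
      forall x y x' y', r x y -> r x' y' -> r (x + x') (y + y'),
      forall x y, r x y -> r (- x) (- y) &
      forall x y x' y', r x y -> r x' y' -> r (x * x') (y * y')].

Lemma rmorph_ring_rel (F G : pzRingType) (f : {rmorphism F -> G}) :
  ring_rel (fun a b => f a = b).
Proof.
split=> [n|a b a' b' <- <-|a b <-|a b a' b' <- <-].
- exact: rmorph_nat.
- exact: rmorphD.
- exact: rmorphN.
- exact: rmorphM.
Qed.

Lemma s_denom_rel (F G : fieldType) (r : F -> G -> Prop) i x y :
  ring_rel r -> vars_rel r x y -> r (s_denom i x) (s_denom i y).
Proof.
case=> rn rD rN rM; case: x y => [? ? ? ? ? [? ? ?]] [? ? ? ? ? [? ? ?]].
case=> /= -[? ? ? ? ?] ? ? ?.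
by elim/ord3_ind: i; rewrite /s_denom /= ?expr2; repeat first
  [assumption | exact: rn | apply: (rD) | apply: (rN) | apply: (rM)].
Qed.

(** Stated for relations rather than for functions, this gives both the
    naturality of the point maps under field morphisms and the computation of
    a substitution on a localization, where it is not yet a morphism of
    fields. *)
Lemma s_vars_rel (F G : fieldType) (r : F -> G -> Prop) i x y :
  ring_rel r -> r (s_denom i x)^-1 (s_denom i y)^-1 ->
  vars_rel r x y -> vars_rel r (s_vars i x) (s_vars i y).
Proof.
case=> rn rD rN rM rV xy.
have rV1 : i = r1 -> r (p2 x)^-1 (p2 y)^-1.
  move=> i1; move: rV; rewrite i1.
  by case: x y {xy} => ? ? ? ? ? [? ? ?] [? ? ? ? ? []].
elim/ord3_ind: i rV rV1 => rV => [_|/(_ erefl) {}rV|_];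
  rewrite ?(s_vars0E, s_vars1E, s_vars2E) -?exprVn; move: rV;
  [move: (s_denom _ x)^-1 (s_denom _ y)^-1 => d e
  |
  |move: (s_denom _ x)^-1 (s_denom _ y)^-1 => d e];
  move: xy; case: x y => [? ? ? ? ? [? ? ?]] [? ? ? ? ? [? ? ?]];
  case=> /= -[? ? ? ? ?] ? ? ? rV;
  by split => /=; first split; rewrite ?expr2; repeat first
    [assumption | exact: rn | apply: (rD) | apply: (rN) | apply: (rM)].
Qed.

Lemma map_s_denom (F G : fieldType) (f : {rmorphism F -> G}) i x :
  s_denom i (map_vars f x) = f (s_denom i x).
Proof. by apply/esym/(s_denom_rel i (rmorph_ring_rel f)). Qed.

Lemma map_s_vars (F G : fieldType) (f : {rmorphism F -> G}) i x :
  s_vars i (map_vars f x) = map_vars f (s_vars i x).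
Proof.
have : vars_rel (fun a b => f a = b) (s_vars i x) (s_vars i (map_vars f x)).
  apply: s_vars_rel => //; first exact: rmorph_ring_rel.
  by rewrite map_s_denom fmorphV.
case: (s_vars i x) (s_vars i (map_vars f x)) =>
  [? ? ? ? ? [? ? ?]] [? ? ? ? ? [? ? ?]].
by rewrite /map_vars /map_params; case=> /= -[-> -> -> -> ->] -> -> ->.
Qed.

(** * The substitutions as field morphisms *)

Lemma normalized_al2 (F : fieldType) (a : params F) :
  normalized a -> al2 a = 1 / 2 - al0 a - al1 a.
Proof. by rewrite /normalized => <-; ring. Qed.

(** The last parameter is left out, as it is a function of the other two. *)
Definition coord (F : fieldType) (x : vars F) (k : 'I_7) : F :=
  nth 0 [:: q1 x; p1 x; q2 x; p2 x; tm x; al0 (par x); al1 (par x)] k.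

Section Substitution.
Variable R : realType.
Local Notation K := (ratfun R).
Local Notation A := (mpoly 7 (cplx R)).
Local Notation X k := (mpolyX (cplx R) (mnm1 k)).
Local Notation g := (generic_vars R).

Definition subst_poly (x : vars K) : {rmorphism A -> K} :=
  mmap (tofrac \o @mpolyC 7 (cplx R)) (coord x).

Lemma subst_polyC x c : subst_poly x (mpolyC 7 c) = rconst c.
Proof. exact: mmapC. Qed.

Lemma subst_polyX x i : subst_poly x (X i) = coord x i.
Proof. by rewrite /= mmapX mmap1U. Qed.

Lemma coord_generic i : coord g i = rvar R i.
Proof.
have inordE (k : 'I_7) : inord k = k by exact: inord_val.
by case: i => [[|[|[|[|[|[|[|//]]]]]]] lti];
   rewrite /coord /= -(inordE (Ordinal lti)).
Qed.

Lemma normalized_generic : normalized (par g).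
Proof. by rewrite /normalized /=; ring. Qed.

Lemma rconst_half : rconst (1 / 2) = 1 / 2 :> K.
Proof.
rewrite -[LHS]/((tofrac \o @mpolyC 7 (cplx R)) (1 / 2)).
by rewrite fmorph_div rmorph1 rmorph_nat.
Qed.

Lemma ratfun_rmorph_eq (L : fieldType) (f f' : {rmorphism K -> L}) :
  (forall c, f (rconst c) = f' (rconst c)) ->
  map_vars f g = map_vars f' g -> f =1 f'.
Proof.
move=> fc [e0 e1 e2 e3 e4 e5 e6 _]; apply: frac_rmorph_eq.
apply: mpoly_alg_ind => //.
- move=> i; rewrite -[tofrac _]/(rvar R i) -coord_generic.
  by case: i => [[|[|[|[|[|[|[|//]]]]]]] lti].
- by move=> p q fp fq; rewrite !rmorphD fp fq.
- by move=> p q fp fq; rewrite !rmorphM fp fq.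
Qed.

Section Lifts.
Variables (phi : {rmorphism A -> K}) (d : A).
Hypothesis d0 : d != 0.
Hypothesis phi_d : phi d = tofrac d.

(** The graph of the extension of phi to the localization A[1/d]: y is f / d^n
    and z is its image phi(f) / d^n. *)
Definition lifts (y z : K) :=
  exists n f, y * tofrac d ^+ n = tofrac f /\ z * tofrac d ^+ n = phi f.

Lemma lifts_poly f : lifts (tofrac f) (phi f).
Proof. by exists 0%N, f; rewrite !mulr1. Qed.

Lemma liftsV : lifts (tofrac d)^-1 (tofrac d)^-1.
Proof. by exists 1%N, 1; rewrite !rmorph1 !expr1 mulVf ?tofrac_eq0. Qed.

Lemma lifts_ring_rel : ring_rel lifts.
Proof.
split=> [n|y z y' z'|y z|y z y' z'].
- by have := lifts_poly n%:R; rewrite !rmorph_nat.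
- case=> n [f [yf zf]] [m [f' [yf' zf']]].
  exists (n + m)%N, (f * d ^+ m + f' * d ^+ n).
  rewrite !rmorphD !rmorphM !rmorphXn /= phi_d.
  by rewrite -yf -zf -yf' -zf' exprD; split; ring.
- by case=> n [f [yf zf]]; exists n, (- f); rewrite !rmorphN /= -yf -zf !mulNr.
- case=> n [f [yf zf]] [m [f' [yf' zf']]].
  exists (n + m)%N, (f * f'); rewrite !rmorphM /=.
  by rewrite -yf -zf -yf' -zf' exprD; split; ring.
Qed.

(** If the extension of phi to A[1/d] sends the image of each variable back to
    this variable, then it sends phi(f) back to f for every polynomial f. *)
Lemma lifts_inj : (forall i, lifts (phi (X i)) (rvar R i)) ->
  (forall c, phi (mpolyC 7 c) = rconst c) -> forall f, phi f = 0 -> f = 0.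
Proof.
move=> liftsX phiC f phif0.
have [_ liftsD _ liftsM] := lifts_ring_rel.
have [n [f' [f'E fE]]] : lifts (phi f) (tofrac f).
  elim/mpoly_alg_ind: f {phif0} => [c|i|p q Pp Pq|p q Pp Pq].
  - by rewrite -[tofrac _]/(rconst c) -(phiC c) {1}phiC; exact: lifts_poly.
  - exact: liftsX.
  - by rewrite !rmorphD; exact: liftsD.
  - by rewrite !rmorphM; exact: liftsM.
move: f'E fE; rewrite phif0 mul0r => /esym/eqP; rewrite tofrac_eq0 => /eqP ->.
rewrite rmorph0 => /eqP; rewrite mulf_eq0 expf_eq0 !tofrac_eq0 (negbTE d0).
by rewrite andbF orbF => /eqP.
Qed.

End Lifts.

Definition denom_poly (i : 'I_3) : A :=
  let X k := X (inord k : 'I_7) in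
  match val i with
  | 0 => 4 * X 1 + X 2 ^+ 2
  | 1 => X 3
  | _ => 4 * X 1 + 8 * X 3 + 4 * X 0 * X 2 - X 2 ^+ 2 + 4 * X 4
  end.

Lemma rmorph_denom (L : fieldType) (psi : {rmorphism A -> L}) x i :
  (forall k, psi (X k) = coord x k) -> psi (denom_poly i) = s_denom i x.
Proof.
move=> psiX.
have XE k (lt_k7 : (k < 7)%N) : psi (X (inord k)) = coord x (Ordinal lt_k7).
  by rewrite psiX; congr coord; apply: val_inj; rewrite /= inordK.
elim/ord3_ind: i; rewrite /denom_poly.
- rewrite -[LHS]/(psi (_ + _)) rmorphD rmorphXn rmorphM rmorph_nat !XE.
  by case: x {psiX XE} => ? ? ? ? ? [].
- rewrite -[LHS]/(psi (X (inord 3))) XE.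
  by case: x {psiX XE} => ? ? ? ? ? [].
- rewrite -[LHS]/(psi (_ + _)) rmorphD rmorphB !rmorphD rmorphXn !rmorphM.
  rewrite !rmorph_nat !XE.
  by case: x {psiX XE} => ? ? ? ? ? [].
Qed.

Lemma subst_denom i x : subst_poly x (denom_poly i) = s_denom i x.
Proof. by apply: rmorph_denom => k; exact: subst_polyX. Qed.

Lemma denom_generic i : s_denom i g = tofrac (denom_poly i).
Proof.
by apply/esym/(rmorph_denom (psi := tofrac)) => k; rewrite coord_generic.
Qed.

Lemma denom_poly_neq0 i : denom_poly i != 0.
Proof.
(* A point at which the three denominators are 4, 1 and 12. *)
pose z : vars (cplx R) := Vars 0 1 0 1 0 (Params 0 0 0).
have : s_denom i z != 0.
  elim/ord3_ind: i.
  - by rewrite /z /= expr0n addr0 mulr1 pnatr_eq0.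
  - exact: oner_neq0.
  - rewrite /z /= expr0n !mulr0 !mulr1 subr0 !addr0.
    by rewrite -(natrD _ 4 8) pnatr_eq0.
rewrite -(rmorph_denom (psi := meval (coord z))) => [|k]; last exact: mevalXU.
by apply: contra_neq => ->; exact: meval0.
Qed.

Lemma denom_generic_neq0 i : s_denom i g != 0.
Proof. by rewrite denom_generic tofrac_eq0 denom_poly_neq0. Qed.

(** The extension of the substitution to A[1/d] sends the generic point g to
    s_i(g), hence s_i(g) to s_i(s_i(g)) = g. *)
Lemma subst_poly_inj i f : subst_poly (s_vars i g) f = 0 -> f = 0.
Proof.
set x := s_vars i g; set phi := subst_poly x; set d := denom_poly i.
have dx : s_denom i x = tofrac d by rewrite s_denomK denom_generic.
have phi_d : phi d = tofrac d by rewrite subst_denom.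
have rel_ring : ring_rel (lifts phi d) by exact: lifts_ring_rel.
have gx k : lifts phi d (coord g k) (coord x k).
  by rewrite coord_generic -[coord x k]subst_polyX; exact: lifts_poly.
have nx : normalized (par x).
  by rewrite par_s_vars; exact/normalized_s/normalized_generic.
have gx_al2 : lifts phi d (al2 (par g)) (al2 (par x)).
  rewrite (normalized_al2 nx) (normalized_al2 normalized_generic).
  have [_ liftsD liftsN _] := rel_ring.
  have half : lifts phi d (1 / 2) (1 / 2).
    by rewrite -rconst_half -{2}(subst_polyC x); exact: lifts_poly.
  by do !apply: (liftsD) => //; apply: liftsN;
    [exact: (gx (@Ordinal 7 5 isT))|exact: (gx (@Ordinal 7 6 isT))].
have gx_rel : vars_rel (lifts phi d) g x.
  split=> //; first split.
  - exact: (gx (@Ordinal 7 0 isT)).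
  - exact: (gx (@Ordinal 7 1 isT)).
  - exact: (gx (@Ordinal 7 2 isT)).
  - exact: (gx (@Ordinal 7 3 isT)).
  - exact: (gx (@Ordinal 7 4 isT)).
  - exact: (gx (@Ordinal 7 5 isT)).
  - exact: (gx (@Ordinal 7 6 isT)).
have : vars_rel (lifts phi d) (s_vars i g) (s_vars i x).
  apply: s_vars_rel => //; rewrite dx denom_generic.
  exact/liftsV/denom_poly_neq0.
rewrite -/x s_varsK ?denom_generic_neq0 // => -[[? ? ? ? ?] ? ? _].
apply: (lifts_inj (denom_poly_neq0 i) phi_d) => [k|c]; last first.
  exact: subst_polyC.
rewrite subst_polyX -coord_generic.
by case: k => [[|[|[|[|[|[|[|//]]]]]]] ltk].
Qed.

Lemma substitution_exists i :
  exists s : {rmorphism K -> K}, is_substitution s (s_vars i g).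
Proof.
have [s sE] := frac_extension (@subst_poly_inj i).
have nx : normalized (par (s_vars i g)).
  by rewrite par_s_vars; exact/normalized_s/normalized_generic.
move: (s_vars i g) nx sE => x nx sE.
have sc c : s (rconst c) = rconst c by rewrite sE subst_polyC.
have sX k (ltk7 : (k < 7)%N) : s (rvar R (inord k)) = coord x (Ordinal ltk7).
  by rewrite sE subst_polyX; congr coord; apply: val_inj; rewrite /= inordK.
exists s; split=> //; rewrite /map_vars /map_params /=.
rewrite !rmorphB -rconst_half sc !sX rconst_half /coord /= -normalized_al2 //.
by case: x {nx sE sX} => ? ? ? ? ? [? ? ?].
Qed.

End Substitution.

(** * The automorphisms satisfy exactly the Coxeter relations *)

Section Realization.
Variable R : realType.
Local Notation K := (ratfun R).
Local Notation X k := (mpolyX (cplx R) (mnm1 k)).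
Local Notation g := (generic_vars R).
Variable sigma : 'I_3 -> {rmorphism K -> K}.
Hypothesis sigmaP : forall i, is_substitution (sigma i) (s_vars i g).

Fixpoint word_morph (w : seq 'I_3) : {rmorphism K -> K} :=
  if w is i :: w' then sigma i \o word_morph w' else idfun.

Lemma word_morphE w : word_action sigma w =1 word_morph w.
Proof. by elim: w => //= i w IHw y; rewrite /= -IHw. Qed.

Lemma word_morph_rcons w i : word_morph (rcons w i) =1 word_morph w \o sigma i.
Proof. by elim: w => //= j w IHw y; rewrite /= IHw. Qed.

Lemma word_morph_const w c : word_morph w (rconst c) = rconst c.
Proof. by elim: w => //= i w ->; have [] := sigmaP i. Qed.

Definition word_vars w := map_vars (word_morph w) g.

Lemma word_vars_inj w w' :
  word_vars w = word_vars w' -> word_morph w =1 word_morph w'.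
Proof. by apply: ratfun_rmorph_eq => c; rewrite !word_morph_const. Qed.

(** The last letter of a word is the first automorphism to act on g, and the
    point map it produces commutes with the other automorphisms. *)
Lemma word_vars_rcons w i : word_vars (rcons w i) = s_vars i (word_vars w).
Proof.
rewrite /word_vars (funext (word_morph_rcons w i)).
rewrite -[LHS]/(map_vars (word_morph w) (map_vars (sigma i) g)).
by have [_ ->] := sigmaP i; rewrite map_s_vars.
Qed.

Lemma word_vars_cat u v :
  word_vars (u ++ v) = foldl (fun x i => s_vars i x) (word_vars u) v.
Proof.
elim: v u => [|i v IHv] u /=; first by rewrite cats0.
by rewrite -cat_rcons IHv word_vars_rcons.
Qed.

(** Along the orbit of the generic point no denominator vanishes, since a field
    morphism is injective. *)
Lemma word_denom_neq0 w i : s_denom i (word_vars w) != 0.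
Proof. by rewrite map_s_denom fmorph_eq0 denom_generic_neq0. Qed.

Lemma word_vars_rel w i j :
  word_vars (w ++ flatten (nseq (cox_m i j) [:: i; j])) = word_vars w.
Proof.
rewrite word_vars_cat.
apply: (@cox_action_rel _ (fun x => exists u, x = word_vars u));
  last by exists w.
- by move=> k _ [u ->]; exists (rcons u k); rewrite word_vars_rcons.
- by move=> k _ [u ->]; exact/s_varsK/word_denom_neq0.
- by move=> y _; exact: s_vars_comm02.
- move=> _ [u ->]; apply: s_vars_braid01; rewrite -?word_vars_rcons;
    exact: word_denom_neq0.
- move=> _ [u ->]; apply: s_vars_braid12; rewrite -?word_vars_rcons;
    exact: word_denom_neq0.
Qed.

Lemma word_action_cox w w' :
  w =c w' -> word_action sigma w =1 word_action sigma w'.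
Proof.
move=> ww' y; rewrite !word_morphE; move: y; apply: word_vars_inj.
elim: ww' => {w w'} [u v i j|w|w w' _ <-|w1 w2 w3 _ -> _ ->] //.
by rewrite catA !word_vars_cat -word_vars_cat word_vars_rel.
Qed.

Lemma sigmaK i : involutive (sigma i).
Proof. exact: (word_action_cox (cox_invol i [::])). Qed.

(** The coordinates y1 (for false) and y2 (for true) of the plane on which the
    group acts by affine maps. *)
Definition weyl_coord (b : bool) : K :=
  if b then al2 (par g) else 1 / 2 - al0 (par g).

Arguments weyl_coord : simpl never.

Lemma sigma_weyl_coord i b : sigma i (weyl_coord b) =
  match val i with
  | 0 => if b then weyl_coord b else 1 - weyl_coord b
  | 1 => weyl_coord (~~ b)
  | _ => if b then - weyl_coord b else weyl_coord b
  end.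
Proof.
have [_ /(congr1 (@par K))] := sigmaP i; rewrite par_s_vars => e.
have e0 : sigma i (al0 (par g)) = al0 (s_params i (par g)) by rewrite -e.
have e2 : sigma i (al2 (par g)) = al2 (s_params i (par g)) by rewrite -e.
have ng := normalized_generic R; rewrite /normalized in ng.
have h : sigma i (1 / 2) = 1 / 2 by rewrite fmorph_div rmorph1 rmorph_nat.
rewrite /weyl_coord; move: (par g) e0 e2 ng {e} => [a0 a1 a2] /= + + ng.
elim/ord3_ind: i h; case: b; rewrite /= ?rmorphB => h e0 e2;
  rewrite ?e2 ?e0 ?h //.
- have n2 : (2 : K) != 0.
    rewrite -(rmorph_nat (tofrac \o @mpolyC 7 (cplx R))) fmorph_eq0.
    by rewrite pnatr_eq0.
  by field.
- by rewrite -ng; ring.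
- by rewrite -ng; ring.
Qed.

Lemma word_action_wreath w :
  let: Wreath n1 e1 n2 e2 s := wreath_of_word w in
  word_action sigma w (weyl_coord s) =
    n1%:~R + (-1) ^+ e1 * weyl_coord false /\
  word_action sigma w (weyl_coord (~~ s)) =
    n2%:~R + (-1) ^+ e2 * weyl_coord true.
Proof.
elim: w => [|i w] /=; first by rewrite !add0r !mul1r.
case: (wreath_of_word w) => n1 e1 n2 e2 s [IH1 IH2].
have E n e s' : sigma i (n%:~R + (-1) ^+ e * weyl_coord s') =
    n%:~R + (-1) ^+ e * sigma i (weyl_coord s').
  by rewrite rmorphD rmorphM rmorph_int rmorph_sign.
elim/ord3_ind: i E => E /=.
- rewrite IH1 IH2 !E !sigma_weyl_coord /=; split=> //.
  by rewrite rmorphD rmorph_sign; case: e1 {IH1}; rewrite ?expr0 ?expr1; ring.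
- by rewrite negbK IH1 IH2 !E !sigma_weyl_coord.
- rewrite IH1 IH2 !E !sigma_weyl_coord /=; split=> //.
  by case: e2 {IH2}; rewrite ?expr0 ?expr1; ring.
Qed.

(** y1 and y2 are affine functions of the independent variables alpha_0 and
    alpha_1, so they can be specialized to any complex numbers a and b. *)
Lemma weyl_coord_indep (n n' : int) (e e' s s' : bool) :
  n%:~R + (-1) ^+ e * weyl_coord s = n'%:~R + (-1) ^+ e' * weyl_coord s' ->
  [/\ n = n', e = e' & s = s'].
Proof.
pose Y b := if b then mpolyC 7 (1 / 2) - X (inord 5) - X (inord 6)
            else mpolyC 7 (1 / 2) - X (inord 5).
have YE b : weyl_coord b = tofrac (Y b).
  by rewrite /weyl_coord /= -rconst_half; case: b; rewrite !rmorphB.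
rewrite !YE -(rmorph_int tofrac n) -(rmorph_int tofrac n').
rewrite -(rmorph_sign tofrac e) -(rmorph_sign tofrac e') -!rmorphM -!rmorphD.
move=> /eqP; rewrite tofrac_eq => /eqP eqY.
have {}eqY (a b : cplx R) : n%:~R + (-1) ^+ e * (if s then b else a) =
    n'%:~R + (-1) ^+ e' * (if s' then b else a) :> cplx R.
  pose v (k : 'I_7) : cplx R :=
    if k == inord 5 then 1 / 2 - a else if k == inord 6 then a - b else 0.
  have vY c : meval v (Y c) = if c then b else a.
    rewrite /Y; case: c; rewrite !mevalB !mevalC !mevalXU /v ?eqxx.
      by rewrite -val_eqE /= !inordK //= !subKr.
    by rewrite subKr.
  have := congr1 (meval v) eqY.
  by rewrite !mevalD !mevalM !vY !rmorph_int !rmorph_sign.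
have := eqY 0 0; rewrite !if_same !mulr0 !addr0 => /eqP.
rewrite eqr_int => /eqP en; move: eqY; rewrite -{}en => eqY.
have {}eqY a b : (-1) ^+ e * (if s then b else a) =
    (-1) ^+ e' * (if s' then b else a) :> cplx R by exact: addrI (eqY a b).
have sign0 (x : bool) : (-1) ^+ x != 0 :> cplx R by rewrite signr_eq0.
have ss : s = s'.
  have := eqY 1 0; case: (s) (s') => -[] //; rewrite mulr0 mulr1 => /eqP.
    by rewrite eq_sym (negbTE (sign0 e')).
  by rewrite (negbTE (sign0 e)).
by split=> //; have := eqY 1 1; rewrite !if_same !mulr1 => /signr_inj ->.
Qed.

Lemma word_action_inj w w' :
  word_action sigma w =1 word_action sigma w' -> w =c w'.
Proof.
move=> ww'; apply: wreath_of_word_inj.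
move: (word_action_wreath w) (word_action_wreath w').
case: (wreath_of_word w) => n1 e1 n2 e2 s.
case: (wreath_of_word w') => n1' e1' n2' e2' s'.
rewrite -!ww' => -[h1 h2] [h1' h2'].
have ss : s = s'.
  apply/eqP; apply: contraT => ss'; have es : s' = ~~ s.
    by case: s s' ss' {h1 h2 h1' h2'} => -[].
  by move: h1'; rewrite es h2 => /weyl_coord_indep [].
move: h1' h2'; rewrite -{}ss h1 h2.
by move=> /weyl_coord_indep [-> -> _] /weyl_coord_indep [-> -> _].
Qed.

End Realization.

Theorem theorem2p1 (R : realType) :
  is_hamiltonian_system R /\
  exists sigma : 'I_3 -> {rmorphism ratfun R -> ratfun R},
    [/\ forall i, is_substitution (sigma i) (s_vars i (generic_vars R)),
        forall i, bijective (sigma i),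
        forall i, preserves_solutions R i &
        forall w w' : seq 'I_3,
          word_action sigma w =1 word_action sigma w' <-> cox_eq w w'].
Proof.
split; first exact: hamiltonian_systemP.
have [sigma sigmaP] := choice (@substitution_exists R).
exists sigma; split=> //.
- by move=> i; exact/inv_bij/sigmaK.
- exact: preserves_solutionsP.
- by move=> w w'; split; [exact: word_action_inj|exact: word_action_cox].
Qed.
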